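(* Let $m \geq 3$ and $n \ge 6$. Then $$\left(\left\lfloor \frac{m}{3}\right\rfloor + \alpha \right) n \le \gamma_{r2}(C_{m} \Box C_n) \le \min \left\{ \left\lceil \frac{m}{3}\right\rceil ( n + \beta),\ \left\lceil \frac{n}{3}\right\rceil (m + \gamma) \right\},$$ where $\alpha = 0$ if $m \equiv 0 \pmod 3$, $\alpha=\frac12$ if $m \equiv 1 \pmod 3$, $\alpha = 1$ if $m \equiv 2 \pmod 3$; $\beta = 0$ if $n \equiv 0 \pmod 6$, $\beta=1$ if $n \equiv 1,2,3,5 \pmod 6$, $\beta=2$ if $n \equiv 4 \pmod 6$; and $\gamma = 0$ if $m \equiv 0 \pmod 6$, $\gamma=1$ if $m \equiv 5 \pmod 6$, $\gamma = 2$ if $m \equiv 1,2,3,4 \pmod 6$.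
   Context: For a graph $G$, a 2-rainbow dominating function (2RDF) is a function $f$ assigning to each vertex a subset of $\{1,2\}$ such that every vertex $v$ with $f(v)=\emptyset$ satisfies $\bigcup_{u\in N(v)} f(u)=\{1,2\}$, where $N(v)$ is the open neighborhood of $v$. Its weight is $w(f)=\sum_{v\in V(G)}|f(v)|$, and $\gamma_{r2}(G)$ is the minimum weight of a 2RDF of $G$. $C_m \Box C_n$ denotes the Cartesian product of the cycles $C_m$ and $C_n$. *)

(* Defs.v *)
From mathcomp Require Import all_boot all_order all_algebra.

Set Implicit Arguments.
Unset Strict Implicit.
Unset Printing Implicit Defensive.

Import Order.TTheory GRing.Theory Num.Theory.

(* Graphs are given by their adjacency relation on a finite vertex type. *)
Definition neighbors (V : finType) (e : rel V) (v : V) : {set V} :=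
  [set u | e v u].

(* The colours 1 and 2 are the two elements of 'I_2. *)
Definition is_2RDF (V : finType) (e : rel V) (f : {ffun V -> {set 'I_2}}) :
    bool :=
  [forall v, (f v == set0) ==>
     (\bigcup_(u in neighbors e v) f u == [set: 'I_2])].

Definition weight (V : finType) (f : {ffun V -> {set 'I_2}}) : nat :=
  \sum_(v : V) #|f v|.

(* The constant function with value {1,2} is always a 2RDF; it only serves as
   the starting point of the minimization. *)
Definition gamma_r2 (V : finType) (e : rel V) : nat :=
  weight [arg min_(f < [ffun=> [set: 'I_2]] | is_2RDF e f) weight f].

Lemma full_is_2RDF (V : finType) (e : rel V) :
  is_2RDF e [ffun=> [set: 'I_2]].
Proof.
apply/forallP => v; apply/implyP; rewrite ffunE => /eqP/setP/(_ ord0).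
by rewrite !inE.
Qed.

Lemma gamma_r2P (V : finType) (e : rel V) :
  (exists2 f, is_2RDF e f & weight f = gamma_r2 e) /\
  (forall f, is_2RDF e f -> gamma_r2 e <= weight f).
Proof.
rewrite /gamma_r2; case: arg_minnP => [|f Hf minf]; first exact: full_is_2RDF.
by split=> //; exists f.
Qed.

(* This is the usual simple cycle when n >= 3. *)
Definition cycle_graph (n : nat) : rel 'I_n :=
  [rel i j : 'I_n | (j == i.+1 %% n :> nat) || (i == j.+1 %% n :> nat)].
Arguments cycle_graph n : clear implicits.

Definition cartesian_product (V W : finType) (e : rel V) (e' : rel W) :
    rel (V * W) :=
  [rel x y : V * W | (x.1 == y.1) && e' x.2 y.2 || (x.2 == y.2) && e x.1 y.1].

Local Open Scope ring_scope.

Definition alpha (m : nat) : rat :=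
  match (m %% 3)%N with 0%N => 0 | 1%N => 1 / 2%:R | _ => 1 end.

Definition beta (n : nat) : rat :=
  match (n %% 6)%N with 0%N => 0 | 4%N => 2%:R | _ => 1 end.

Definition gamma (m : nat) : rat :=
  match (m %% 6)%N with 0%N => 0 | 5%N => 1 | _ => 2%:R end.

(* Main.v *)
Require Import Defs.
From mathcomp Require Import all_boot all_order all_algebra.
From mathcomp Require Import zify lra.

Set Implicit Arguments.
Unset Strict Implicit.
Unset Printing Implicit Defensive.

Import Order.TTheory GRing.Theory Num.Theory.

(* Lower bound: if a_y is the weight of the y-th copy of C_m, counting colours
   seen by its empty vertices gives 2m <= a_(y-1) + 4 a_y + a_(y+1).  Hence a
   column lighter than t/2, where t = 2 (m %/ 3) + m %% 3, has neighbours heavy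
   enough to compensate, and the average column weight is at least t/2.
   Upper bound: contracting an edge layer shows that gamma_r2 (C_m x C_n) is
   nondecreasing in m and n, and lifting along the covering C_(3k) -> C_3
   reduces the claim to gamma_r2 (C_3 x C_n) <= n + beta n, where a diagonal
   pattern works unless n = 4 mod 6; that case follows from n + 1 by
   contraction. *)

(** * Transfer of 2-rainbow domination along graph maps *)

Lemma is_2RDFP (V : finType) (e : rel V) (f : {ffun V -> {set 'I_2}}) :
  reflect (forall v c, f v = set0 -> exists2 u, e v u & c \in f u)
          (is_2RDF e f).
Proof.
apply: (iffP forallP) => [H v c fv0 | H v].
  have := H v; rewrite fv0 eqxx /= => /eqP/setP/(_ c).
  by rewrite inE => /bigcupP[u]; rewrite inE => evu cu; exists u.
apply/implyP => /eqP fv0; apply/eqP/setP => c; rewrite inE.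
by have [u evu cu] := H v c fv0; apply/bigcupP; exists u; rewrite // inE.
Qed.

Lemma gamma_r2_le (V : finType) (e : rel V) (f : {ffun V -> {set 'I_2}}) :
  is_2RDF e f -> gamma_r2 e <= weight f.
Proof. by case: (gamma_r2P e) => _; apply. Qed.

Lemma leq_card_bigcup (I T : finType) (P : pred I) (F : I -> {set T}) :
  #|\bigcup_(i | P i) F i| <= \sum_(i | P i) #|F i|.
Proof.
elim/big_ind2: _ => [|A x B y leA leB|//]; first by rewrite cards0.
by apply: leq_trans (leq_add leA leB); apply: leq_card_setU.
Qed.

(* Contracting edges preserves 2-rainbow domination: a vertex is empty after
   the contraction only if its whole fibre was. *)
Lemma gamma_r2_contract (V W : finType) (e : rel V) (e' : rel W)
    (phi : V -> W) :
  (forall w, exists v, phi v = w) ->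
  (forall u v, e u v -> phi u = phi v \/ e' (phi u) (phi v)) ->
  gamma_r2 e' <= gamma_r2 e.
Proof.
move=> surj hom; have [[f /is_2RDFP fP <-] _] := gamma_r2P e.
pose g := [ffun w => \bigcup_(v | phi v == w) f v].
apply: (@leq_trans (weight g)).
  apply/gamma_r2_le/is_2RDFP => w c gw0; have [v vw] := surj w.
  have sub u : phi u = w -> f u = set0.
    move=> uw; apply/eqP; rewrite -subset0 -gw0 ffunE.
    by apply: bigcup_sup; apply/eqP.
  have [u evu cu] := fP v c (sub v vw); exists (phi u).
    case: (hom _ _ evu) => [vu|]; last by rewrite vw.
    by move: cu; rewrite sub ?inE // -vu.
  by rewrite ffunE; apply/bigcupP; exists u.
rewrite /weight (partition_big phi predT) //=.
by apply: leq_sum => w _; rewrite ffunE; apply: leq_card_bigcup.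
Qed.

(** An optimal function pulls back along [phi]: neighbours lift, so both colours are still seen, and
    each vertex below is counted at most [k] times. *)
Lemma gamma_r2_cover (V W : finType) (e : rel V) (e' : rel W)
    (phi : V -> W) (k : nat) :
  (forall v w, e' (phi v) w -> exists2 u, e v u & phi u = w) ->
  (forall w, #|[set v | phi v == w]| <= k) ->
  gamma_r2 e <= k * gamma_r2 e'.
Proof.
move=> lift fib; have [[f /is_2RDFP fP <-] _] := gamma_r2P e'.
apply: (@leq_trans (weight [ffun v => f (phi v)])).
  apply/gamma_r2_le/is_2RDFP => v c; rewrite ffunE => /(fP _ c)[w /lift].
  by move=> [u evu uw] cw; exists u; rewrite // ffunE uw.
rewrite /weight (partition_big phi predT) //= big_distrr /=.
apply: leq_sum => w _.
rewrite (eq_bigr (fun=> #|f w|)); last by move=> v /eqP vw; rewrite ffunE vw.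
rewrite sum_nat_const leq_mul2r; apply/orP; right.
by have := fib w; rewrite cardsE.
Qed.

Lemma gamma_r2_swap (V W : finType) (e : rel V) (e' : rel W) :
  gamma_r2 (cartesian_product e e') <= gamma_r2 (cartesian_product e' e).
Proof.
apply: (@gamma_r2_contract _ _ _ _ (fun v => (v.2, v.1))) => [[x y]|u v].
  by exists (y, x).
by rewrite /cartesian_product /= orbC; right.
Qed.

(** * Contracting and covering cycles *)

(** Removes the variable modulus [n], so that [lia] can decide adjacency. *)
Lemma cycle_graphE n (i j : 'I_n) :
  cycle_graph n i j = [|| j == i.+1 :> nat, i == j.+1 :> nat,
    (i == n.-1 :> nat) && (j == 0 :> nat) |
    (j == n.-1 :> nat) && (i == 0 :> nat)].
Proof.
have succ_mod (a : 'I_n) : a.+1 %% n = if a == n.-1 :> nat then 0 else a.+1.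
  have an := ltn_ord a; case: eqP => [an1|/eqP an1].
    by rewrite an1 prednK ?modnn //; lia.
  by rewrite modn_small //; lia.
have := ltn_ord i; have := ltn_ord j.
by rewrite /cycle_graph /= !succ_mod; do 2 case: ifP; lia.
Qed.

Lemma cycle_graph_ordS n (i j : 'I_n) :
  cycle_graph n i j -> j = ordS i \/ j = ord_pred i.
Proof.
case/orP => /eqP ij; [left | right]; first exact/val_inj.
by apply: (can_inj (@ordSK n)); rewrite ord_predK; apply/val_inj.
Qed.

Lemma gamma_r2_cycleS m (W : finType) (e : rel W) : 0 < m ->
  gamma_r2 (cartesian_product (cycle_graph m) e) <=
  gamma_r2 (cartesian_product (cycle_graph m.+1) e).
Proof.
(* [phi] merges the last two vertices of the longer cycle. *)
case: m => // m _; pose phi (i : 'I_m.+2) : 'I_m.+1 := inord (minn i m).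
have phiE i : phi i = minn i m :> nat by rewrite inordK; lia.
apply: (@gamma_r2_contract _ _ _ _ (fun v => (phi v.1, v.2))) => [[x y]|].
  have xm := ltn_ord x; exists (widen_ord (leqnSn _) x, y); congr (_, _) => /=.
  by apply: val_inj; rewrite /= phiE /=; lia.
move=> [x y] [x' y']; rewrite /cartesian_product /=.
case/orP => /andP[/eqP-> exy]; first by right; rewrite eqxx exy.
rewrite eqxx /=; have [->|neq] := eqVneq (phi x) (phi x'); first by left.
right; apply/orP; right; move: neq exy.
rewrite -val_eqE /= !cycle_graphE !phiE.
by have := ltn_ord x; have := ltn_ord x'; lia.
Qed.

Lemma gamma_r2_cycle_mono m m' (W : finType) (e : rel W) :
  0 < m -> m <= m' ->
  gamma_r2 (cartesian_product (cycle_graph m) e) <=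
  gamma_r2 (cartesian_product (cycle_graph m') e).
Proof.
move=> m0 /subnKC<-; elim: (m' - m) => [|d IH]; first by rewrite addn0.
by rewrite addnS (leq_trans IH) // gamma_r2_cycleS // addn_gt0 m0.
Qed.

Lemma gamma_r2_cycle_cover3 k (W : finType) (e : rel W) : 0 < k ->
  gamma_r2 (cartesian_product (cycle_graph (k * 3)) e) <=
  k * gamma_r2 (cartesian_product (cycle_graph 3) e).
Proof.
move=> k0; pose phi (i : 'I_(k * 3)) : 'I_3 := inord (i %% 3).
have phiE i : phi i = i %% 3 :> nat by rewrite inordK ?ltn_mod.
apply: (@gamma_r2_cover _ _ _ _ (fun v => (phi v.1, v.2))) => [[x y] [z y']|].
  rewrite /cartesian_product /= => /orP[] /andP[/eqP<- adj].
    by exists (x, y'); rewrite //= eqxx adj.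
  suff [u xu uz] : exists2 u, cycle_graph (k * 3) x u & phi u = z.
    by exists (u, y); rewrite /= ?uz // eqxx xu orbT.
  have kP : 0 < k * 3 by lia.
  have lt3 a : (if a < k * 3 then a else 0) < k * 3 by case: ifP.
  (* The cyclic successor and predecessor of [x]; wrapping around respects residues because 3
     divides the length. *)
  pose u1 := Ordinal (lt3 x.+1).
  pose u2 := Ordinal (lt3 (if x == 0 :> nat then (k * 3).-1 else x.-1)).
  have xk := ltn_ord x; have z3 := ltn_ord z.
  have [zx|zx] := eqVneq (nat_of_ord z) (x.+1 %% 3).
    exists u1; first by rewrite cycle_graphE /=; case: ifP; lia.
    by apply: val_inj; rewrite /= phiE zx /=; case: ifP; lia.
  move: adj; rewrite cycle_graphE phiE => adj.
  exists u2; first by rewrite cycle_graphE /=; do 2 case: ifP; lia.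
  by apply: val_inj; rewrite /= phiE /=; do 2 case: ifP; lia.
move=> [a y].
have div3 (x : 'I_(k * 3)) : x %/ 3 < k by rewrite ltn_divLR.
rewrite -[leqRHS]card_ord.
(* Within a fibre the residue mod 3 and [y] are fixed, so the quotient by 3 determines the
   vertex. *)
rewrite -(card_in_imset (f := fun v => Ordinal (div3 v.1))) ?max_card //.
move=> [x1 y1] [x2 y2]; rewrite !inE.
move=> /eqP[/(congr1 val)/= + ->] /eqP[/(congr1 val)/= + ->] [].
by rewrite !phiE => ? ? ?; congr (_, _); apply: val_inj => /=; lia.
Qed.

(** * The upper bound for [C_3 x C_n] *)

(* Perfect diagonal pattern of period 6; one extra colour in the last column
   plays the part of column -1, closing the pattern up. *)
Definition diag_fun (n : nat) : {ffun 'I_3 * 'I_n -> {set 'I_2}} :=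
  [ffun v : 'I_3 * 'I_n => [set c : 'I_2 |
     (v.1 == v.2 %% 3 :> nat) && (c == v.2 %% 2 :> nat)
     || [&& v.2 == n.-1 :> nat, v.1 == 2 :> nat & c == 1 :> nat]]].

(** An empty vertex of column [y] sees colour [y %% 2] inside its column and the other colour in
    column [y + 1] or [y - 1], according to its row; only the seam between columns [n - 1] and 0
    needs care. *)
Lemma diag_fun_2RDF n : 2 < n -> n %% 6 != 4 ->
  is_2RDF (cartesian_product (cycle_graph 3) (cycle_graph n)) (diag_fun n).
Proof.
move=> n2 n4; apply/is_2RDFP => -[x y] c /setP fv0.
have x3 := ltn_ord x; have yn := ltn_ord y; have c2 := ltn_ord c.
have mod2 : y %% 2 < 2 by rewrite ltn_mod.
(* Colour [y %% 2] puts [x] off the diagonal; colour 1 excludes the vertex carrying the extra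
   colour. *)
have := fv0 (Ordinal (isT : 1 < 2)); have := fv0 (Ordinal mod2).
rewrite !ffunE !inE /= eqxx !andbT => xy xl {fv0}.
have vertical x' : x' < 3 -> x != x' :> nat ->
    (x' == y %% 3) && (c == y %% 2 :> nat)
      || [&& y == n.-1 :> nat, x' == 2 & c == 1 :> nat] ->
    exists2 u, cartesian_product (cycle_graph 3) (cycle_graph n) (x, y) u
             & c \in diag_fun n u.
  move=> lt3 xx' cu; exists (Ordinal lt3, y); last by rewrite ffunE inE.
  by apply/orP; right; rewrite /= eqxx cycle_graphE /=; lia.
have horizontal y' : y' < n ->
    [|| y' == y.+1, y == y'.+1 :> nat |
        (y == 0 :> nat) && (y' == n.-1) || (y == n.-1 :> nat) && (y' == 0)] ->
    (x == y' %% 3 :> nat) && (c == y' %% 2 :> nat)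
      || [&& y' == n.-1, x == 2 :> nat & c == 1 :> nat] ->
    exists2 u, cartesian_product (cycle_graph 3) (cycle_graph n) (x, y) u
             & c \in diag_fun n u.
  move=> ltn {xy xl vertical} yy' cu; exists (x, Ordinal ltn); last by rewrite ffunE inE.
  by apply/orP; left; rewrite /= eqxx cycle_graphE /=; lia.
have [cy|cy] := eqVneq (nat_of_ord c) (y %% 2).
  by apply: (vertical (y %% 3)); lia.
have left_column : y != 0 :> nat -> x == y.-1 %% 3 :> nat ->
    exists2 u, cartesian_product (cycle_graph 3) (cycle_graph n) (x, y) u
             & c \in diag_fun n u.
  move=> {xy xl vertical} y0 xE.
  have cE : c == y.-1 %% 2 :> nat by lia.
  by apply: (horizontal y.-1); [lia | lia | rewrite xE cE].
have [xS|xS] := eqVneq (nat_of_ord x) (y.+1 %% 3); last first.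
  have [y0|y0] := eqVneq (nat_of_ord y) 0.
    (* Here [x] is 2 and [c] is 1: the extra colour of the last column. *)
    by apply: (horizontal n.-1); move: {horizontal vertical left_column} xy xl; lia.
  by apply: left_column => //; move: {horizontal vertical} xy xl; lia.
have [yl|yl] := eqVneq (nat_of_ord y) n.-1; last first.
  have cE : c == y.+1 %% 2 :> nat by lia.
  by apply: (horizontal y.+1); rewrite ?eqxx ?xS ?eqxx ?cE //; lia.
(* Now [x = n %% 3] and [c = n %% 2]. Colour 1 is the extra one of this column. If [c] is 0, then
   [n] is even; residue 2 mod 6 would make [x] the row of the extra colour, hence nonempty, and 4 is
   excluded. So 6 divides [n], and vertex [(0, 0)] supplies colour 0. *)
have [c1|c1] := eqVneq (nat_of_ord c) 1.
  by apply: (vertical 2); lia.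
by apply: (horizontal 0); lia.
Qed.

Lemma card_le_bool (T : finType) (A : {set T}) (a : T) (b : bool) :
  (forall c, c \in A -> c = a /\ b) -> #|A| <= b.
Proof.
case: b => H.
  rewrite -[leqRHS](cards1 a) subset_leq_card //.
  by apply/subsetP => c /H[-> _]; rewrite inE.
by rewrite leqn0 cards_eq0; apply/eqP/setP => c; rewrite inE; apply/negP => /H[].
Qed.

(** The diagonal spends one colour per column. When 6 divides [n], the extra colour is already on
    the diagonal and costs nothing. *)
Lemma weight_diag_fun n : 0 < n ->
  weight (diag_fun n) <= n + (n %% 6 != 0).
Proof.
case: n => // n _.
pose A (v : 'I_3 * 'I_n.+1) := [set c : 'I_2 |
  (v.1 == v.2 %% 3 :> nat) && (c == v.2 %% 2 :> nat)].
pose B (v : 'I_3 * 'I_n.+1) := [set c : 'I_2 |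
  [&& n.+1 %% 6 != 0, v == (inord 2, ord_max) & c == 1 :> nat]].
have sub v : diag_fun n.+1 v \subset A v :|: B v.
  case: v => x y; apply/subsetP => c; rewrite !ffunE !inE /= xpair_eqE -!val_eqE /=.
  by rewrite inordK //; lia.
have cA v : #|A v| <= (v.1 == v.2 %% 3 :> nat).
  apply: (@card_le_bool _ _ (inord (v.2 %% 2))) => c; rewrite inE.
  case/andP => -> /eqP cE; split=> //.
  by apply: val_inj; rewrite /= cE inordK ?ltn_mod.
have cB v : #|B v| <= (n.+1 %% 6 != 0) * (v == (inord 2, ord_max)).
  rewrite mulnb; apply: (@card_le_bool _ _ (inord 1)) => c; rewrite inE.
  case/and3P => -> -> /eqP cE; split=> //.
  by apply: val_inj; rewrite /= cE inordK.
apply: (@leq_trans (\sum_(v : 'I_3 * 'I_n.+1) ((v.1 == v.2 %% 3 :> nat) +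
                         (n.+1 %% 6 != 0) * (v == (inord 2, ord_max))))).
  apply: leq_sum => v _; apply: leq_trans (subset_leq_card (sub v)) _.
  exact: leq_trans (leq_card_setU _ _) (leq_add (cA v) (cB v)).
rewrite big_split /= -big_distrr /=; apply: leq_add.
  rewrite -(pair_bigA _ (fun (x : 'I_3) (y : 'I_n.+1) =>
                           (x == y %% 3 :> nat) : nat)) /=.
  rewrite exchange_big /= -[leqRHS]card_ord -sum1_card.
  apply: leq_sum => y _; rewrite !big_ord_recl big_ord0 /=.
  by case: (y %% 3) => [|[|[|]]].
by rewrite (bigD1 (inord 2, ord_max)) //= eqxx big1 ?muln1 // => v /negPf->.
Qed.

Lemma gamma_r2_C3 n : 2 < n ->
  ((gamma_r2 (cartesian_product (cycle_graph 3) (cycle_graph n)))%:R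
     <= n%:R + beta n)%R.
Proof.
have diag k : 2 < k -> k %% 6 != 4 ->
    gamma_r2 (cartesian_product (cycle_graph 3) (cycle_graph k))
      <= k + (k %% 6 != 0).
  move=> k2 k4; apply: leq_trans (gamma_r2_le (diag_fun_2RDF k2 k4)) _.
  by apply: weight_diag_fun; lia.
move=> n2.
pose b : nat := if n %% 6 == 4 then 2 else n %% 6 != 0.
have ->: beta n = (b%:R)%R.
  rewrite /b /beta; have: n %% 6 < 6 by rewrite ltn_mod.
  by case: (n %% 6) => [|[|[|[|[|[|?]]]]]].
rewrite -natrD ler_nat /b.
case: eqP => [n4|/eqP]; last exact: diag.
(* [n.+1] has residue 5, so its pattern weighs at most [n + 2]; the swaps bring the cycle to be
   contracted into the first factor. *)
apply: leq_trans (gamma_r2_swap _ _) _.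
apply: leq_trans (gamma_r2_cycleS _ _) _; first by lia.
apply: leq_trans (gamma_r2_swap _ _) _.
by apply: leq_trans (diag n.+1 _ _) _; lia.
Qed.

(** * The upper bound for [C_m x C_n] *)

Lemma ceil_div3 m : (Num.ceil (m%:R / 3%:R : rat) = ((m + 2) %/ 3)%:Z)%R.
Proof.
apply: ceil_def; rewrite ltr_pdivlMr // ler_pdivrMr //.
rewrite -[(3%:R)%R]/((3%:Z)%:~R)%R -[(m%:R)%R]/((m%:Z)%:~R)%R -!intrM.
by rewrite ltr_int ler_int; lia.
Qed.

Lemma floor_div3 m : (Num.floor (m%:R / 3%:R : rat) = (m %/ 3)%:Z)%R.
Proof.
apply: floor_def; rewrite ler_pdivlMr // ltr_pdivrMr //.
rewrite -[(3%:R)%R]/((3%:Z)%:~R)%R -[(m%:R)%R]/((m%:Z)%:~R)%R -!intrM.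
by rewrite ltr_int ler_int; lia.
Qed.

(** Lengthen [C_m] to the next multiple of 3, then cover [C_3]. *)
Lemma gamma_r2_torus_le m n : 0 < m -> 2 < n ->
  ((gamma_r2 (cartesian_product (cycle_graph m) (cycle_graph n)))%:R
     <= (Num.ceil (m%:R / 3%:R : rat))%:~R * (n%:R + beta n))%R.
Proof.
move=> m0 n2; rewrite ceil_div3; set k := (m + 2) %/ 3.
have k0 : 0 < k by rewrite /k; lia.
apply: le_trans (_ : (k%:R * (gamma_r2 (cartesian_product (cycle_graph 3)
                                 (cycle_graph n)))%:R <= _)%R).
  rewrite -natrM ler_nat; apply: leq_trans (gamma_r2_cycle_cover3 _ k0).
  by apply: gamma_r2_cycle_mono; rewrite // /k; lia.
by apply: ler_wpM2l; [rewrite ler0n | apply: gamma_r2_C3].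
Qed.

(** Exchanging the factors yields the second bound with [beta m], which this relaxes to
    [gamma m]. *)
Lemma beta_le_gamma m : (beta m <= gamma m)%R.
Proof.
rewrite /beta /gamma; have: m %% 6 < 6 by rewrite ltn_mod.
by case: (m %% 6) => [|[|[|[|[|[|?]]]]]].
Qed.

(** * The lower bound *)

Lemma sum_ordS n (F : 'I_n -> nat) : \sum_i F (ordS i) = \sum_i F i.
Proof. by rewrite [RHS](reindex _ (onW_bij _ (@ordS_bij n))). Qed.

Lemma sum_ord_pred n (F : 'I_n -> nat) : \sum_i F (ord_pred i) = \sum_i F i.
Proof. by rewrite [RHS](reindex _ (onW_bij _ (@ord_pred_bij n))). Qed.

(* Discharging: each column in excess hands half of its excess to each of its
   two neighbours. *)
Lemma cyclic_average n (a : 'I_n -> nat) (t : nat) :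
  (forall i, 2 * a i < t ->
     2 * t <= 2 * a i + a (ordS i) + a (ord_pred i)) ->
  t * n <= 2 * \sum_i a i.
Proof.
(* [p i - t] is the doubled excess. [share] says that half the excesses of the neighbours cover a
   deficit; elsewhere it only uses [t <= p]. *)
move=> H; pose p i := maxn (2 * a i) t.
have share i : 2 * p i + 2 * t <= 4 * a i + p (ordS i) + p (ord_pred i).
  by have := H i; rewrite /p; lia.
have := leq_sum (index_enum 'I_n) (P := predT) (fun i _ => share i).
rewrite !big_split /= !big1_eq (sum_ordS p) (sum_ord_pred p).
rewrite sum_nat_const card_ord mulnC.
by set A := \sum_i a i; set B := \sum_i p i; lia.
Qed.

Definition column_weight m n (f : {ffun 'I_m * 'I_n -> {set 'I_2}})
    (y : 'I_n) : nat := \sum_x #|f (x, y)|.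

(** Each vertex counts its own colours twice and those of its neighbours once: a nonempty vertex
    reaches 2 alone, an empty one through its neighbours. In the sum over a column, the two vertical
    neighbours raise the coefficient from 2 to 4. *)
Lemma column_demand m n (f : {ffun 'I_m * 'I_n -> {set 'I_2}}) (y : 'I_n) :
  is_2RDF (cartesian_product (cycle_graph m) (cycle_graph n)) f ->
  2 * m <= 4 * column_weight f y + column_weight f (ordS y)
             + column_weight f (ord_pred y).
Proof.
move=> /is_2RDFP fP.
have demand x : 2 <= 2 * #|f (x, y)| + #|f (ordS x, y)| + #|f (ord_pred x, y)|
                   + #|f (x, ordS y)| + #|f (x, ord_pred y)|.
  have [fv0|fv] := eqVneq (f (x, y)) set0; last by move: fv; rewrite -card_gt0; lia.
  rewrite fv0 cards0 muln0 add0n.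
  apply: (@leq_trans #|f (ordS x, y) :|: f (ord_pred x, y) :|: f (x, ordS y)
                       :|: f (x, ord_pred y)|); last first.
    do 3 (apply: leq_trans (leq_card_setU _ _) _; rewrite leq_add2r).
    by [].
  rewrite -[leqLHS](card_ord 2) subset_leq_card //; apply/subsetP => c _.
  have [[x' y'] + cu] := fP _ c fv0; rewrite /cartesian_product /=.
  move: cu => /[swap]; rewrite !inE.
  by case/orP => /andP[/eqP<- /cycle_graph_ordS[]->] ->; rewrite ?orbT.
have := leq_sum (index_enum 'I_m) (P := predT) (fun x _ => demand x).
rewrite !big_split /= !big1_eq sum_nat_const card_ord.
rewrite (sum_ordS (fun x => #|f (x, y)|)) (sum_ord_pred (fun x => #|f (x, y)|)).
by rewrite -!/(column_weight f _); lia.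
Qed.

Lemma gamma_r2_torus_ge m n :
  (2 * (m %/ 3) + m %% 3) * n <=
  2 * gamma_r2 (cartesian_product (cycle_graph m) (cycle_graph n)).
Proof.
have [[f f2 <-] _] := gamma_r2P (cartesian_product (cycle_graph m) (cycle_graph n)).
have -> : weight f = \sum_y column_weight f y.
  rewrite exchange_big /= pair_bigA /weight.
  by apply: eq_bigr => -[].
(* Let [m = 3q + r], [t = 2q + r] and [2a < t]. The demand gives
   [2a + a' + a'' >= 2m - 2a >= 4q + r + 1], enough for [2t] if [r <= 1]; if [r = 2], parity gives
   [2a <= 2q], which suffices. *)
apply: cyclic_average => y; have := column_demand y f2.
have: m %% 3 < 3 by rewrite ltn_mod.
have := divn_eq m 3.
lia.
Qed.

Local Open Scope ring_scope.

Theorem theorem2 (m n : nat) (hm : (3 <= m)%N) (hn : (6 <= n)%N) :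
  let g : rat :=
    (gamma_r2 (cartesian_product (cycle_graph m) (cycle_graph n)))%:R in
  let m3 : rat := m%:R / 3%:R in
  let n3 : rat := n%:R / 3%:R in
  ((Num.floor m3)%:~R + alpha m) * n%:R <= g
  /\ g <= Num.min ((Num.ceil m3)%:~R * (n%:R + beta n))
                  ((Num.ceil n3)%:~R * (m%:R + gamma m)).
Proof.
move=> g m3 n3; split.
  have alphaE : alpha m = (m %% 3)%:R / 2%:R.
    rewrite /alpha; have: (m %% 3 < 3)%N by rewrite ltn_mod.
    by case: (m %% 3)%N => [|[|[|?]]].
  have := gamma_r2_torus_ge m n; rewrite -(ler_nat rat) !natrM natrD natrM -/g.
  by rewrite floor_div3 alphaE; lra.
rewrite le_min; apply/andP; split.
  by apply: gamma_r2_torus_le; lia.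
apply: le_trans (_ : _ <= (Num.ceil n3)%:~R * (m%:R + beta m)) _.
  apply: le_trans (gamma_r2_torus_le _ _); [|lia|lia].
  by rewrite ler_nat gamma_r2_swap.
by rewrite /n3 ceil_div3 ler_wpM2l ?ler0n // lerD2l beta_le_gamma.
Qed.
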